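(* Let $\mathfrak n$ be a 2-step nilpotent Lie algebra with an HKT structure $(\{J_i\}_{i=1,2,3},g)$, let $N$ be a Lie group with Lie algebra $\mathfrak n$ endowed with the induced invariant HKT structure, let $\nabla$ be its Bismut connection and $c$ its torsion 3-form. Let $\mathfrak z$ be the center of $\mathfrak n$ and $\mathfrak v=\mathfrak z^{\perp}$. Then: (i) the Ricci tensor of $\nabla$ is symmetric; (ii) $c$ is co-closed, i.e. $d^*c=0$; (iii) every left-invariant 1-form $\alpha$ on $N$ belonging to the dual $\mathfrak z^*$ of the center (i.e. vanishing on $\mathfrak v$) is parallel with respect to $\nabla$; (iv) the Lee forms $\theta_i=J_id^*F_i$, $i=1,2,3$, all vanish.
   Context: A hypercomplex structure on a (finite-dimensional real) Lie algebra $\mathfrak g$ is a triple of endomorphisms $\{J_i\}_{i=1,2,3}$ with $J_i^2=-I$, $J_1J_2=-J_2J_1=J_3$ and vanishing Nijenhuis tensors $N_i(X,Y)=J_i([X,Y]-[J_iX,J_iY])-([J_iX,Y]+[X,J_iY])$. An HKT structure on $\mathfrak g$ is a hypercomplex structure with an inner product $g$ such that $g(J_iX,J_iY)=g(X,Y)$ for $i=1,2,3$, and such that $g([J_iX,J_iY],Z)+g([J_iY,J_iZ],X)+g([J_iZ,J_iX],Y)$ is independent of $i\in\{1,2,3\}$ for all $X,Y,Z\in\mathfrak g$. Left translating $J_i$ and $g$ gives an invariant HKT structure on any Lie group with Lie algebra $\mathfrak g$; its Bismut connection is the unique connection $\nabla$ with $\nabla g=0$, $\nabla J_i=0$ ($i=1,2,3$)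 and with $c(X,Y,Z)=g(X,T(Y,Z))$ a 3-form ($T$ the torsion of $\nabla$); $c$ is the torsion 3-form. The curvature of $\nabla$ is $R(X,Y)=[\nabla_X,\nabla_Y]-\nabla_{[X,Y]}$ and its Ricci tensor is the trace $\sum_j g(R(X,e_j)Y,e_j)$ over an orthonormal basis $\{e_j\}$ (up to an overall sign convention, which is irrelevant here). $F_i=g(J_i\cdot,\cdot)$ is the Kähler form of $(J_i,g)$, and $d^*$ is the codifferential of the Riemannian metric $g$. A Lie algebra $\mathfrak n$ is 2-step nilpotent if $[\mathfrak n,\mathfrak n]\ne0$ and $[[\mathfrak n,\mathfrak n],\mathfrak n]=0$. *)

(* Defs.v *)
From mathcomp Require Import all_boot all_order all_algebra.
From mathcomp Require Import reals.

Set Implicit Arguments.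
Unset Strict Implicit.
Unset Printing Implicit Defensive.

Import Order.TTheory GRing.Theory Num.Theory.
Local Open Scope ring_scope.

(* Left-invariant tensors and connections on a Lie group are identified with
   tensors on its Lie algebra V (the values on left-invariant vector fields).
   The functions g(X, Y), alpha(X), ... obtained by evaluating left-invariant
   tensors on left-invariant fields are constant, so the terms
   X(alpha(Y, ..)) in the usual formulas for covariant derivatives vanish.
   A left-invariant connection is the bilinear map (X, Y) |-> nabla_X Y.
   An inner product on V is a form g : {dot V for idfun}, i.e. a symmetric
   positive definite bilinear form. *)

Section LieAlgebra.
Variables (R : realType) (V : vectType R).
Implicit Types (br : {bilinear V -> V -> V}).

Definition is_lie_bracket br : Prop :=
  (forall X, br X X = 0) /\
  (forall X Y Z, br X (br Y Z) + br Y (br Z X) + br Z (br X Y) = 0).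

Definition two_step_nilpotent br : Prop :=
  (exists X Y, br X Y <> 0) /\ (forall X Y Z, br (br X Y) Z = 0).

Definition center br (Z : V) : Prop := forall X, br Z X = 0.

Definition orthogonal_compl (g : {dot V for idfun}) (S : V -> Prop) (X : V) :
  Prop := forall Y, S Y -> g X Y = 0.

Definition nijenhuis br (J : 'End(V)) (X Y : V) : V :=
  J (br X Y - br (J X) (J Y)) - (br (J X) Y + br X (J Y)).

(* J_1, J_2, J_3 are J 0, J 1, J 2. *)
Definition is_hypercomplex br (J : 'I_3 -> 'End(V)) : Prop :=
  [/\ forall i X, J i (J i X) = - X,
      forall X, J 0 (J 1 X) = J 2 X,
      forall X, - J 1 (J 0 X) = J 2 X
    & forall i X Y, nijenhuis br (J i) X Y = 0].

Definition is_HKT br (J : 'I_3 -> 'End(V)) (g : {dot V for idfun}) : Prop :=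
  [/\ is_hypercomplex br J,
      forall i X Y, g (J i X) (J i Y) = g X Y
    & forall i k X Y Z,
        g (br (J i X) (J i Y)) Z + g (br (J i Y) (J i Z)) X
          + g (br (J i Z) (J i X)) Y
        = g (br (J k X) (J k Y)) Z + g (br (J k Y) (J k Z)) X
          + g (br (J k Z) (J k X)) Y].

End LieAlgebra.

Section Connections.
Variables (R : realType) (V : vectType R).
Implicit Types (br nabla D : {bilinear V -> V -> V}) (g : {dot V for idfun}).

Definition torsion br nabla (X Y : V) : V := nabla X Y - nabla Y X - br X Y.

Definition is_metric g nabla : Prop :=
  forall X Y Z, g (nabla X Y) Z + g Y (nabla X Z) = 0.

Definition is_levi_civita br g D : Prop :=
  is_metric g D /\ (forall X Y, torsion br D X Y = 0).

Definition torsion_form br g nabla (X Y Z : V) : R :=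
  g X (torsion br nabla Y Z).

(* Trilinearity of torsion_form is automatic, so being a 3-form amounts to
   being alternating. *)
Definition is_bismut br (J : 'I_3 -> 'End(V)) g nabla : Prop :=
  let c := torsion_form br g nabla in
  [/\ is_metric g nabla,
      forall i X Y, nabla X (J i Y) = J i (nabla X Y)
    & forall X Y, [/\ c X X Y = 0, c X Y X = 0 & c X Y Y = 0]].

Definition curvature br nabla (X Y Z : V) : V :=
  nabla X (nabla Y Z) - nabla Y (nabla X Z) - nabla (br X Y) Z.

Definition is_orthonormal_basis g (e : (\dim {:V}).-tuple V) : Prop :=
  basis_of fullv e /\ (forall i j, g (tnth e i) (tnth e j) = (i == j)%:R).

Definition ricci br g nabla (e : (\dim {:V}).-tuple V) (X Y : V) : R :=
  \sum_j g (curvature br nabla X (tnth e j) Y) (tnth e j).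

Definition cov1 nabla (X : V) (a : V -> R) (Y : V) : R := - a (nabla X Y).

Definition cov2 nabla (X : V) (a : V -> V -> R) (Y Z : V) : R :=
  - a (nabla X Y) Z - a Y (nabla X Z).

Definition cov3 nabla (X : V) (a : V -> V -> V -> R) (Y Z W : V) : R :=
  - a (nabla X Y) Z W - a Y (nabla X Z) W - a Y Z (nabla X W).

(* d^* a = - sum_j (D_{e_j} a)(e_j, ..), with D the Levi-Civita connection of g
   and e an orthonormal basis. *)
Definition codiff2 D (e : (\dim {:V}).-tuple V) (a : V -> V -> R) (X : V) : R :=
  - \sum_j cov2 D (tnth e j) a (tnth e j) X.

Definition codiff3 D (e : (\dim {:V}).-tuple V) (a : V -> V -> V -> R)
    (X Y : V) : R :=
  - \sum_j cov3 D (tnth e j) a (tnth e j) X Y.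

Definition kahler_form (J : 'End(V)) g (X Y : V) : R := g (J X) Y.

(* J acts on 1-forms by (J a)(X) = - a (J X). *)
Definition lee_form (J : 'End(V)) g D (e : (\dim {:V}).-tuple V) (X : V) : R :=
  - codiff2 D e (kahler_form J g) (J X).

End Connections.

(* Main.v *)
From HB Require Import structures.
Require Import Defs.
From mathcomp Require Import all_boot all_order all_algebra.
From mathcomp Require Import reals ring lra.

Set Implicit Arguments.
Unset Strict Implicit.
Unset Printing Implicit Defensive.

Import Order.TTheory GRing.Theory Num.Theory.
Local Open Scope ring_scope.

(** The heart of the matter is that an HKT structure on a 2-step nilpotent Lie
    algebra is abelian: [J_i X, J_i Y] = [X, Y] for every i ([HKT_abelian]).
    If X is central, integrability of J_i gives
    [J_i X, J_i Y] = J_i [J_i X, Y], so that w = [J_i X, Y] and J_i w are both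
    brackets, hence central.  A central vector w with one central image J_i w
    has all three images central, by the HKT identity for i and k at the
    vectors w, Y and J_k [J_k w, Y] ([central_J_next]).  Against such
    a w, the HKT identity reduces to
    g([J_i X, J_i Y], w) = g([X, Y], w)
    ([dot_bracket_JJ_stable_central]).  Taking for w the vectors
    [J_i X, J_i Y] with X central gives J_i X central ([center_J_stable]); so
    the whole center is stable under the J_i, and taking then for w the central
    vector [J_i X, J_i Y] - [X, Y] shows that it vanishes.

    For an abelian structure, g(nabla_X Y, Z) = - g(X, [Y, Z]) is a metric
    connection that commutes with J_i and has skew torsion, and the Bismut
    connection is unique ([bismut_connectionE]).  Hence
    c(X, Y, Z) = - (g([X, Y], Z) + g([Y, Z], X) + g([Z, X], Y)), and
    nabla_X Y is orthogonal to the center, which is the parallelism of the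
    1-forms in the dual of the center.  The other assertions are contractions
    over an orthonormal basis in which 2-step nilpotency kills every nested
    bracket and every trace of ad:
    - Ric(X, Y) = sum_j g([X, e_j], [Y, e_j]) ([ricciE]), which is symmetric;
    - (d^* c)(X, Y) = S(X, Y) - S(Y, X), where
      S(X, Y) = sum_j c(e_j, D_(e_j) X, Y) satisfies
      2 S(X, Y) = sum_jk g([e_j, e_k], X) g([e_j, e_k], Y), again symmetric
      ([contract_torsion_form]);
    - the Lee form of J_i is a multiple of sum_j g([e_j, J_i e_j], J_i X), which
      changes sign when e is replaced by its image under another J_k
      ([lee_form_abelian]). *)

(** * Inner products and orthonormal bases *)

Section InnerProduct.
Variables (R : realType) (V : vectType R) (g : {dot V for idfun}).

Lemma dotC X Y : g X Y = g Y X.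
Proof. by rewrite hermC expr0 mul1r. Qed.

Lemma dot_self_eq0 X : g X X = 0 -> X = 0.
Proof.
move=> gXX; apply/eqP; apply: contraTT isT => /(@neq0_dnorm_gt0 _ _ _ g).
by rewrite gXX ltxx.
Qed.

Lemma dot_inj X Y : (forall Z, g X Z = g Y Z) -> X = Y.
Proof.
move=> gXY; apply/eqP; rewrite -subr_eq0; apply/eqP/dot_self_eq0.
by rewrite linearBl /= gXY subrr.
Qed.

Lemma dot_skew (J : 'End(V)) :
    (forall X, J (J X) = - X) -> (forall X Y, g (J X) (J Y) = g X Y) ->
  forall X Y, g (J X) Y = - g X (J Y).
Proof. by move=> JJ gJ X Y; rewrite -[LHS]gJ JJ linearNl. Qed.

Section OrthonormalBasis.
Variables (e : (\dim {:V}).-tuple V) (he : is_orthonormal_basis g e).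

Lemma orthonormal_expansion X : X = \sum_j g X (tnth e j) *: tnth e j.
Proof.
have [be ge] := he.
have Xe: X \in <<e>>%VS by rewrite (span_basis be) memvf.
have defX: X = \sum_j coord e j X *: tnth e j.
  by rewrite {1}(coord_span Xe); apply: eq_bigr => j _; rewrite (tnth_nth 0).
rewrite {1}defX; apply: eq_bigr => j _; congr (_ *: _).
rewrite [in RHS]defX linear_sumlz (bigD1 j) //= linearZl_LR /= ge eqxx mulr1.
rewrite big1 ?addr0 // => i ij.
by rewrite linearZl_LR /= ge (negPf ij) mulr0.
Qed.

Lemma contract (phi : V -> R) (X : V) :
  scalar phi -> \sum_j g X (tnth e j) * phi (tnth e j) = phi X.
Proof.
move=> phi_lin.
pose f := GRing.isLinear.Build _ _ _ _ phi phi_lin.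
pose F : {linear V -> R | *%R} := HB.pack phi f.
transitivity (F X) => //; rewrite [in RHS](orthonormal_expansion X) linear_sum.
by apply: eq_bigr => j _; rewrite linearZ.
Qed.

End OrthonormalBasis.
End InnerProduct.


(** * Traces and contractions *)

Section Contractions.
Variables (R : realType) (V : vectType R) (g : {dot V for idfun}).
Variables (e : (\dim {:V}).-tuple V) (he : is_orthonormal_basis g e).

Lemma trace_mulC (A B : 'End(V)) :
  \sum_j g (A (B (tnth e j))) (tnth e j)
  = \sum_j g (B (A (tnth e j))) (tnth e j).
Proof.
transitivity (\sum_j \sum_k g (B (tnth e j)) (tnth e k)
                            * g (A (tnth e k)) (tnth e j)).
  apply: eq_bigr => j _; rewrite (contract he (phi := fun W => g (A W) _)) //.
  by move=> a u v; rewrite !(linearP, linearPl).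
rewrite exchange_big; apply: eq_bigr => k _ /=.
rewrite -(contract he (phi := fun W => g (B W) _)).
  by apply: eq_bigr => j _; rewrite mulrC.
by move=> a u v; rewrite !(linearP, linearPl).
Qed.

(** If P projects onto the image of A, then P A = A while A P = 0, because A
    kills its own image; the two products have the same trace. *)
Lemma trace_square_zero (A : 'End(V)) :
  (forall X, A (A X) = 0) -> \sum_j g (A (tnth e j)) (tnth e j) = 0.
Proof.
move=> AA; pose P := projv (limg A).
transitivity (\sum_j g (P (A (tnth e j))) (tnth e j)).
  by apply: eq_bigr => j _; rewrite projv_id // memv_img ?memvf.
rewrite trace_mulC big1 // => j _.
have /memv_imgP[X _ ->] := memv_proj (limg A) (tnth e j).
by rewrite AA linear0l.
Qed.

(** The trace of a bilinear form is the same in the orthonormal bases J e_j and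
    e_j: expand the first J e_j along e, then contract the second argument,
    J being skew. *)
Lemma contract_orthogonal (J : 'End(V)) (b : V -> V -> R) :
    (forall X, J (J X) = - X) -> (forall X Y, g (J X) (J Y) = g X Y) ->
    (forall W, scalar (b W)) -> (forall W, scalar (b^~ W)) ->
  \sum_j b (J (tnth e j)) (J (tnth e j)) = \sum_j b (tnth e j) (tnth e j).
Proof.
move=> JJ gJ br_lin bl_lin.
transitivity (\sum_j \sum_k g (J (tnth e j)) (tnth e k)
                            * b (tnth e k) (J (tnth e j))).
  by apply: eq_bigr => j _; rewrite (contract he (phi := b^~ _)).
rewrite exchange_big; apply: eq_bigr => k _ /=.
have -> : b (tnth e k) (tnth e k) = b (tnth e k) (J (- J (tnth e k))).
  by rewrite linearN /= JJ opprK.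
rewrite -(contract he (phi := fun W => b (tnth e k) (J W))).
  by apply: eq_bigr => j _; rewrite (dot_skew JJ gJ) (dotC g _ (J _)) linearNl.
by move=> a u v; rewrite linearP br_lin.
Qed.

End Contractions.

(** * The Levi-Civita connection *)

Section LeviCivita.
Variables (R : realType) (V : vectType R) (br D : {bilinear V -> V -> V}).
Variables (g : {dot V for idfun}).
Hypothesis hD : is_levi_civita br g D.

Lemma levi_civita_torsion_free X Y : D X Y - D Y X = br X Y.
Proof. by have [_ /(_ X Y)/eqP] := hD; rewrite subr_eq0 => /eqP. Qed.

Lemma koszul X Y Z :
  2 * g (D X Y) Z = g (br X Y) Z - g (br Y Z) X + g (br Z X) Y.
Proof.
have [metric _] := hD.
rewrite -!levi_civita_torsion_free !linearBl /=.
have := metric X Y Z; have := metric Y Z X; have := metric Z X Y.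
rewrite !(dotC g _ (D _ _)); lra.
Qed.

(** For a torsion-free connection, skew-symmetrizing the covariant derivative of
    a 1-form, here the dual of Z, gives its exterior derivative. *)
Lemma levi_civita_skew_part X Y Z :
  g (D X Z) Y - g (D Y Z) X = - g Z (br X Y).
Proof.
have [metric _] := hD; rewrite -levi_civita_torsion_free linearBr /=.
have := metric X Z Y; have := metric Y Z X.
rewrite !(dotC g _ (D _ _)); lra.
Qed.

End LeviCivita.

(** * Brackets and integrable complex structures *)

Section LieBracket.
Variables (R : realType) (V : vectType R) (br : {bilinear V -> V -> V}).
Hypotheses (hbr : is_lie_bracket br) (hnil : two_step_nilpotent br).

Lemma bracketC X Y : br X Y = - br Y X.
Proof.
have [alt _] := hbr; have := alt (X + Y).
rewrite linearDl !linearDr /= !alt add0r addr0 => /eqP.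
by rewrite addr_eq0 => /eqP.
Qed.

Lemma bracket_centralr X Z : center br Z -> br X Z = 0.
Proof. by move=> cZ; rewrite bracketC cZ oppr0. Qed.

Lemma center_opp Z : center br Z -> center br (- Z).
Proof. by move=> cZ Y; rewrite linearNl /= cZ oppr0. Qed.

Lemma center_bracket X Y : center br (br X Y).
Proof. by case: hnil => _ /(_ X Y). Qed.

Section Nijenhuis.
Variables (J : 'End(V)).
Hypotheses (JJ : forall X, J (J X) = - X)
           (NJ : forall X Y, nijenhuis br J X Y = 0).

Lemma bracket_JJ X Y : br (J X) (J Y) = br X Y + J (br (J X) Y + br X (J Y)).
Proof.
have /eqP := NJ X Y; rewrite subr_eq0 => /eqP <-.
by rewrite JJ opprB addrC subrK.
Qed.

Lemma bracket_JJ_central X Y :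
  center br X -> br (J X) (J Y) = J (br (J X) Y).
Proof. by move=> cX; rewrite bracket_JJ !cX add0r addr0. Qed.

Lemma bracket_abelian :
    (forall X Y, br (J X) (J Y) = br X Y) ->
  forall X Y, br (J X) Y = - br X (J Y).
Proof. by move=> abJ X Y; rewrite -[LHS]abJ JJ linearNl. Qed.

End Nijenhuis.
End LieBracket.

(** * HKT structures on 2-step nilpotent algebras are abelian *)

Lemma ord3_ind (P : 'I_3 -> Prop) : P 0 -> P 1 -> P 2 -> forall i, P i.
Proof.
move=> P0 P1 P2 [[|[|[|//]]] lti].
- by rewrite (_ : Ordinal lti = 0) //; apply/val_inj.
- by rewrite (_ : Ordinal lti = 1) //; apply/val_inj.
- by rewrite (_ : Ordinal lti = 2) //; apply/val_inj.
Qed.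

Section HKT.
Variables (R : realType) (V : vectType R) (br : {bilinear V -> V -> V}).
Variables (J : 'I_3 -> 'End(V)) (g : {dot V for idfun}).
Hypotheses (hbr : is_lie_bracket br) (hnil : two_step_nilpotent br).
Hypothesis hHKT : is_HKT br J g.

Let JJ i X : J i (J i X) = - X. Proof. by case: hHKT => [[]]. Qed.
Let NJ i X Y : nijenhuis br (J i) X Y = 0. Proof. by case: hHKT => [[]]. Qed.
Let gJ i X Y : g (J i X) (J i Y) = g X Y. Proof. by case: hHKT. Qed.
Let HKT : forall i k X Y Z,
  g (br (J i X) (J i Y)) Z + g (br (J i Y) (J i Z)) X
    + g (br (J i Z) (J i X)) Y
  = g (br (J k X) (J k Y)) Z + g (br (J k Y) (J k Z)) X
    + g (br (J k Z) (J k X)) Y.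
Proof. by case: hHKT. Qed.

(** The indices are treated up to cyclic permutation: all the products, and
    with J J = - 1 the anticommutation rules, follow from these three. *)
Definition quaternionic_triple (i k l : 'I_3) : Prop :=
  forall X, [/\ J i (J k X) = J l X, J k (J l X) = J i X & J l (J i X) = J k X].

Lemma quaternionic_triple_rot i k l :
  quaternionic_triple i k l -> quaternionic_triple k l i.
Proof. by move=> q X; have [] := q X. Qed.

Lemma quaternionic_triple012 : quaternionic_triple 0 1 2.
Proof.
have [[_ J01 J10 _] _ _] := hHKT.
move=> X; split; first exact: J01.
  by rewrite -J01 -[LHS]opprK J10 -J01 (JJ 1) linearN opprK.
by rewrite -J10 (JJ 0) linearN opprK.
Qed.

(** The vectors w = [J_k X, Y] and J_l w are central; the second because
    J_l J_k X = - J_i X is central, so that integrability of J_l makes J_l w a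
    bracket.  As J_k J_k w = - w and J_i J_k w = J_l w, all terms of the HKT
    identity for i and k at (X, Y, J_k w) vanish except
    g([J_k X, J_k Y], J_k w), which is |w|^2 because [J_k X, J_k Y] = J_k w. *)
Lemma central_J_next i k l X : quaternionic_triple i k l ->
  center br X -> center br (J i X) -> center br (J k X).
Proof.
move=> q cX ciX Y; set w := br (J k X) Y.
have cw : center br w by exact: center_bracket.
have JlJk Z : J l (J k Z) = - J i Z.
  by have [_ _ <-] := q Z; rewrite JJ.
have clw : center br (J l w).
  have lk : center br (J l (J k X)) by rewrite JlJk; apply: center_opp.
  have kl : br (J k X) (J l Y) = J l w.
    have := congr1 (J l) (bracket_JJ (@JJ l) (@NJ l) (J k X) Y).
    rewrite !lk add0r linear0 linearD /= JJ => /eqP.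
    by rewrite eq_sym subr_eq0 => /eqP.
  by rewrite -kl; exact: center_bracket.
have JiJk Z : J i (J k Z) = J l Z by have [] := q Z.
have := HKT i k X Y (J k w).
rewrite JiJk JJ !(bracket_centralr hbr _ clw) !clw.
rewrite (bracket_centralr hbr _ (center_opp cw)) (center_opp cw).
rewrite !linear0l !addr0.
rewrite ciX linear0l (bracket_JJ_central (@JJ k) (@NJ k)) // gJ.
by move=> /esym/dot_self_eq0.
Qed.

Lemma central_J_all i X :
  center br X -> center br (J i X) -> forall k, center br (J k X).
Proof.
move=> cX.
have q0 := quaternionic_triple012.
have q1 := quaternionic_triple_rot q0; have q2 := quaternionic_triple_rot q1.
have c01 := central_J_next q0 cX; have c12 := central_J_next q1 cX.
have c20 := central_J_next q2 cX.
by move: i; apply: ord3_ind => c; apply: ord3_ind; auto.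
Qed.

(** The HKT identity with Z in the third slot says that the form
    b_i(X, Y) = g([J_i X, J_i Y], Z) is the same for all i.
    Since J_2 = J_0 J_1,
    b_2(X, Y) = b_0(J_1 X, J_1 Y) = b_1(J_1 X, J_1 Y) = g([X, Y], Z). *)
Lemma dot_bracket_JJ_stable_central i X Y Z :
    center br Z -> (forall k, center br (J k Z)) ->
  g (br (J i X) (J i Y)) Z = g (br X Y) Z.
Proof.
move=> cZ cJZ.
have b_indep m n U W : g (br (J m U) (J m W)) Z = g (br (J n U) (J n W)) Z.
  have := HKT m n U W Z.
  by rewrite !(bracket_centralr hbr _ (cJZ _)) !cJZ !linear0l !addr0.
have J01 U : J 2 U = J 0 (J 1 U) by have [-> _ _] := quaternionic_triple012 U.
rewrite (b_indep i 2) !J01 (b_indep 0 1) !(JJ 1).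
by rewrite linearNl linearNr /= opprK.
Qed.

(** The vector w = [J_i X, Y] is central together with J_i w = [J_i X, J_i Y],
    so w and J_i w lie in the part of the center stable under all the J_k;
    by the previous lemma g([J_i X, J_i Y], J_i w) = g([X, Y], J_i w) = 0. *)
Lemma center_J_stable i X : center br X -> center br (J i X).
Proof.
move=> cX Y; set w := br (J i X) Y.
have cw : center br w by exact: center_bracket.
have Jw : br (J i X) (J i Y) = J i w by exact: bracket_JJ_central.
have cJw : center br (J i w) by rewrite -Jw; exact: center_bracket.
apply/(@dot_self_eq0 _ _ g); rewrite -(gJ i) -{1}Jw.
rewrite dot_bracket_JJ_stable_central ?cX ?linear0l //.
by apply: (central_J_all (i := i)); rewrite // JJ; exact: center_opp.
Qed.

Lemma HKT_abelian i X Y : br (J i X) (J i Y) = br X Y.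
Proof.
apply/eqP; rewrite -subr_eq0; apply/eqP/(@dot_self_eq0 _ _ g).
set w := _ - _; have cw : center br w.
  by move=> Z; rewrite linearBl /= !center_bracket // subrr.
rewrite {1}/w linearBl /= dot_bracket_JJ_stable_central ?subrr //.
by move=> k; exact: center_J_stable.
Qed.

End HKT.

(** * The Bismut connection of an abelian structure *)

Section Bismut.
Variables (R : realType) (V : vectType R).
Variables (br nabla : {bilinear V -> V -> V}) (g : {dot V for idfun}).
Variables (J : 'I_3 -> 'End(V)) (i : 'I_3).
Hypothesis hbr : is_lie_bracket br.
Hypothesis JJ : forall X, J i (J i X) = - X.
Hypothesis gJ : forall X Y, g (J i X) (J i Y) = g X Y.
Hypothesis abJ : forall X Y, br (J i X) (J i Y) = br X Y.
Hypothesis hnabla : is_bismut br J g nabla.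

(** A nonzero 3-form cannot be J-invariant in a pair of arguments: it would be
    so in every pair, and then t(X, Y, Z) = t(X, JY, JZ) = - t(JJX, JY, JZ)
    = - t(JX, Y, JZ) = - t(X, Y, Z). *)
Lemma alternating_J_invariant_eq0 (t : V -> V -> V -> R) :
    (forall X Y Z, t X Y Z = - t Y X Z) ->
    (forall X Y Z, t X Y Z = - t X Z Y) ->
    (forall X Y Z, t X (J i Y) (J i Z) = t X Y Z) ->
    (forall X Y Z, t (- X) Y Z = - t X Y Z) ->
  forall X Y Z, t X Y Z = 0.
Proof.
move=> t12 t23 tJ tN X Y Z.
have t13 A B C : t (J i A) B (J i C) = t A B C.
  by rewrite t12 tJ -t12.
have t12J A B C : t (J i A) (J i B) C = t A B C.
  by rewrite t23 t13 -t23.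
have := tJ X Y Z.
have <-: - t (J i (J i X)) (J i Y) (J i Z) = t X (J i Y) (J i Z).
  by rewrite JJ tN opprK.
by rewrite t12J t13; lra.
Qed.

Lemma torsion_form_skew12 X Y Z :
  torsion_form br g nabla X Y Z = - torsion_form br g nabla Y X Z.
Proof.
have [_ _ alt] := hnabla.
have [cXX _ _] := alt X Z; have [cYY _ _] := alt Y Z.
have [+ _ _] := alt (X + Y) Z; move: cXX cYY.
rewrite /torsion_form /torsion !(linearDl, linearDr, linearBl, linearBr) /=.
lra.
Qed.

(** The difference t(X, Y, Z) = g(nabla_X Y, Z) + g(X, [Y, Z]) between the two
    connections is skew and J-invariant in (Y, Z).  The skew-symmetry of c in
    its first two arguments amounts to the cyclic invariance of t, so t is a
    3-form and vanishes. *)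
Lemma bismut_connectionE X Y Z : g (nabla X Y) Z = - g X (br Y Z).
Proof.
have [metric nablaJ _] := hnabla.
pose t A B C := g (nabla A B) C + g A (br B C).
have t23 A B C : t A B C = - t A C B.
  rewrite /t (bracketC hbr B) linearNr /=.
  by have := metric A B C; rewrite (dotC g B); lra.
have tcyc A B C : t A B C = t B C A.
  have := torsion_form_skew12 A B C.
  have := metric C A B; have := metric A B C.
  rewrite /torsion_form /torsion /t !linearBr /= (bracketC hbr A C) linearNr /=.
  by rewrite (dotC g A (nabla B C)) (dotC g B (nabla C A)); lra.
suff: t X Y Z = 0 by rewrite /t => /eqP; rewrite addr_eq0 => /eqP.
apply: alternating_J_invariant_eq0 => [A B C|||A B C]; last first.
- by rewrite /t !linearNl /=; lra.
- by move=> A B C; rewrite /t !nablaJ gJ abJ.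
- exact: t23.
- by rewrite tcyc t23.
Qed.
End Bismut.

(** * Curvature, codifferential and Lee forms *)

Section AbelianTwoStep.
Variables (R : realType) (V : vectType R) (br : {bilinear V -> V -> V}).
Variables (g : {dot V for idfun}).
Variables (e : (\dim {:V}).-tuple V) (he : is_orthonormal_basis g e).
Hypotheses (hbr : is_lie_bracket br) (hnil : two_step_nilpotent br).

Local Notation E := (tnth e).

Lemma trace_ad X : \sum_j g (br X (E j)) (E j) = 0.
Proof.
pose A : 'End(V) := linfun (br X).
have AE Y : A Y = br X Y by rewrite lfunE.
rewrite -[RHS](trace_square_zero he (A := A)).
  by apply: eq_bigr => j _; rewrite AE.
by move=> Y; rewrite !AE bracket_centralr //; exact: center_bracket.
Qed.

(** The contraction of the nested bracket [[Y, Z], Z]. *)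
Lemma sum_bracket_bracket X Y Z :
  \sum_j g (E j) (br Y Z) * g X (br (E j) Z) = 0.
Proof.
transitivity (g X (br (br Y Z) Z)); last by rewrite center_bracket // linear0r.
rewrite -(contract he (phi := fun W => g X (br W Z))).
  by apply: eq_bigr => j _; rewrite (dotC g (E j)).
by move=> a u v; rewrite linearPl linearPr.
Qed.

Section Connections.
Variables (nabla D : {bilinear V -> V -> V}).
Hypothesis nablaE : forall X Y Z, g (nabla X Y) Z = - g X (br Y Z).
Hypothesis hD : is_levi_civita br g D.

Lemma torsion_formE X Y Z : torsion_form br g nabla X Y Z =
  - (g (br X Y) Z + g (br Y Z) X + g (br Z X) Y).
Proof.
rewrite /torsion_form /torsion !linearBr /= !(dotC g X) !nablaE.
by rewrite (bracketC hbr Y X) linearNr /= (dotC g Y) (dotC g Z); lra.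
Qed.

Lemma ricciE X Y :
  ricci br g nabla e X Y = \sum_j g (br X (E j)) (br Y (E j)).
Proof.
have first0 : \sum_j g X (br (nabla (E j) Y) (E j)) = 0.
  (* Expanding nabla_(e_j) Y turns the sum into one of terms
     g(X, [[Y, e_k], e_k]). *)
  transitivity (\sum_j \sum_k
      g (nabla (E j) Y) (E k) * g X (br (E k) (E j))).
    apply: eq_bigr => j _.
    rewrite (contract he (phi := fun W => g X (br W _))) //.
    by move=> a u v; rewrite linearPl linearPr.
  rewrite exchange_big big1 // => k _ /=.
  rewrite -[RHS](sum_bracket_bracket X Y (E k)).
  apply: eq_bigr => j _.
  by rewrite nablaE (bracketC hbr (E k)) linearNr /= mulrNN.
have second0 : \sum_j g (E j) (br (nabla X Y) (E j)) = 0.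
  by rewrite -[RHS](trace_ad (nabla X Y)); apply: eq_bigr => j _; rewrite dotC.
rewrite -[RHS]addr0 -[X in _ + X]second0 -[RHS]subr0 -[X in _ - X]first0.
rewrite -big_split -sumrB.
apply: eq_bigr => j _ /=.
by rewrite /curvature !linearBl /= !nablaE; lra.
Qed.

Lemma sum_levi_civita_diag : \sum_j D (E j) (E j) = 0.
Proof.
apply: (@dot_inj _ _ g) => X; rewrite linear_sumlz linear0l /=.
rewrite -[RHS](trace_ad X); apply: eq_bigr => j _.
have := koszul hD (E j) (E j) X; rewrite (bracketC hbr X).
by have [-> _] := hbr; rewrite linear0l linearNl; lra.
Qed.

(** Expanding D_(e_j) X along the basis pairs g(D_(e_j) X, e_k) with the skew
    form c(e_j, e_k, Y), so that only the difference
    g(D_(e_j) X, e_k) - g(D_(e_k) X, e_j) = - g(X, [e_j, e_k]) counts.  Of the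
    three terms of c, two contract to nested brackets. *)
Lemma contract_torsion_form X Y :
  2 * \sum_j torsion_form br g nabla (E j) (D (E j) X) Y
  = \sum_j \sum_k g (br (E j) (E k)) X * g (br (E j) (E k)) Y.
Proof.
pose c := torsion_form br g nabla.
have c_lin U W : scalar (fun Z => c U Z W).
  move=> a u v; rewrite /c !torsion_formE !(linearPl, linearPr) /=; ring.
have expand : \sum_j c (E j) (D (E j) X) Y
    = \sum_j \sum_k g (D (E j) X) (E k) * c (E j) (E k) Y.
  by apply: eq_bigr => j _; rewrite (contract he _ (c_lin _ _)).
have cskew U W : c U W Y = - c W U Y.
  rewrite /c !torsion_formE (bracketC hbr W U) (bracketC hbr U Y).
  by rewrite (bracketC hbr Y W) !linearNl /=; lra.
have expandC : \sum_j c (E j) (D (E j) X) Y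
    = - \sum_j \sum_k g (D (E k) X) (E j) * c (E j) (E k) Y.
  rewrite expand exchange_big -sumrN; apply: eq_bigr => j _ /=.
  by rewrite -sumrN; apply: eq_bigr => k _; rewrite cskew mulrN.
have cross1 : \sum_j \sum_k g X (br (E j) (E k)) * g (br (E k) Y) (E j) = 0.
  rewrite exchange_big big1 // => k _ /=.
  rewrite -[RHS]oppr0 -[in RHS](sum_bracket_bracket X Y (E k)) -sumrN.
  apply: eq_bigr => j _.
  by rewrite (bracketC hbr _ Y) linearNl /= (dotC g (E j)); ring.
have cross2 : \sum_j \sum_k g X (br (E j) (E k)) * g (br Y (E j)) (E k) = 0.
  rewrite big1 // => j _.
  rewrite -[RHS]oppr0 -[in RHS](sum_bracket_bracket X Y (E j)) -sumrN.
  apply: eq_bigr => k _.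
  by rewrite (bracketC hbr (E j)) linearNr /= (dotC g (E k)); ring.
rewrite mulr_natl mulr2n {1}expand expandC -sumrB.
rewrite -[RHS]addr0 -[X in _ + X]cross1 -[RHS]addr0 -[X in _ + X]cross2.
rewrite -!big_split.
apply: eq_bigr => j _ /=; rewrite -sumrB -!big_split; apply: eq_bigr => k _ /=.
rewrite -mulrBl (levi_civita_skew_part hD) /c torsion_formE !(dotC g X); ring.
Qed.

(** The terms in D_(e_j) e_j add up to zero, and the other two are the symmetric
    contraction of the previous lemma at (X, Y) and, with the opposite sign, at
    (Y, X). *)
Lemma codiff_torsion_form X Y :
  codiff3 D e (torsion_form br g nabla) X Y = 0.
Proof.
set c := torsion_form br g nabla.
have diag0 : \sum_j c (D (E j) (E j)) X Y = 0.
  pose phi W := c W X Y.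
  transitivity (phi (\sum_j D (E j) (E j))).
    rewrite /phi /c torsion_formE !(linear_sumlz, linear_sumr) /=.
    rewrite -!big_split -sumrN /=.
    by apply: eq_bigr => j _; rewrite torsion_formE.
  rewrite sum_levi_civita_diag /phi /c torsion_formE.
  by rewrite !(linear0l, linear0r); rewrite ?linear0l !addr0 oppr0.
have sym : \sum_j c (E j) (D (E j) X) Y = \sum_j c (E j) (D (E j) Y) X.
  apply: (@mulfI _ 2); first by rewrite pnatr_eq0.
  rewrite !contract_torsion_form; apply: eq_bigr => j _; apply: eq_bigr => k _.
  by rewrite mulrC.
rewrite /codiff3 -sumrN -[RHS](subrr (\sum_j c (E j) (D (E j) X) Y)).
rewrite [X in _ - X]sym -[RHS]add0r -[X in X + _]diag0 -sumrB -big_split /=.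
apply: eq_bigr => j _; rewrite /cov3 /c !torsion_formE.
rewrite (bracketC hbr (E j) X) (bracketC hbr X (D _ Y)).
by rewrite (bracketC hbr (D _ Y) (E j)) !linearNl /=; lra.
Qed.

(** Besides traces of ad, the Lee form of J contains
    sum_j g([e_j, J e_j], J X); passing to the orthonormal basis K e_j changes
    its sign, because J K = - K J. *)
Lemma lee_form_abelian (J K : 'End(V)) X :
    (forall Y, J (J Y) = - Y) -> (forall Y, K (K Y) = - Y) ->
    (forall Y, J (K Y) = - K (J Y)) ->
    (forall Y Z, g (J Y) (J Z) = g Y Z) ->
    (forall Y Z, g (K Y) (K Z) = g Y Z) ->
    (forall Y Z, br (J Y) (J Z) = br Y Z) ->
    (forall Y Z, br (K Y) (K Z) = br Y Z) ->
  lee_form J g D e X = 0.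
Proof.
move=> JJ KK JK gJ gK abJ abK.
have [metric _] := hD.
have traceJ : \sum_j g (br X (J (E j))) (J (E j)) = 0.
  rewrite -[RHS](trace_ad X).
  apply: (contract_orthogonal he (b := fun U W => g (br X U) W)) => //.
    by move=> W a u v; rewrite linearPr.
  by move=> W a u v; rewrite linearPr linearPl.
have traceK : \sum_j g (br (E j) (J (E j))) (J X) = 0.
  have: \sum_j g (br (K (E j)) (J (K (E j)))) (J X)
      = \sum_j g (br (E j) (J (E j))) (J X).
    pose b U W := g (br U (J W)) (J X).
    apply: (contract_orthogonal he (b := b)) => //.
      by move=> W a u v; rewrite /b linearP linearPr linearPl.
    by move=> W a u v; rewrite /b !linearPl.
  under eq_bigr do rewrite JK linearNr /= abK linearNl /=.
  rewrite sumrN; lra.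
have diag0 : \sum_j g (D (E j) (E j)) X = 0.
  rewrite -(linear_sumlz g). 
  by rewrite sum_levi_civita_diag linear0l.
have twist0 : 2 * \sum_j g (D (E j) (J (E j))) (J X) = 0.
  rewrite mulr_sumr -[RHS]subr0 -[X in _ - X]traceJ -[X in X - _]traceK.
  rewrite -[RHS]addr0 -[X in _ + X](trace_ad X) -sumrB -!big_split.
  apply: eq_bigr => j _ /=; rewrite (koszul hD) abJ.
  have -> : br (J X) (E j) = - br X (J (E j)).
    exact: (bracket_abelian JJ abJ).
  rewrite (bracketC hbr (E j) X) !linearNl /=; lra.
have {twist0} twist0 : \sum_j g (D (E j) (J (E j))) (J X) = 0 by lra.
rewrite /lee_form /codiff2 opprK -[RHS]subr0 -[X in _ - X]diag0.
rewrite -[X in X - _]twist0.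
rewrite -sumrB; apply: eq_bigr => j _ /=.
rewrite /cov2 /kahler_form gJ.
have := metric (E j) (J (E j)) (J X); lra.
Qed.

End Connections.
End AbelianTwoStep.

Theorem mainTheorem4 (R : realType) (V : vectType R)
  (br : {bilinear V -> V -> V}) (J : 'I_3 -> 'End(V)) (g : {dot V for idfun})
  (nabla D : {bilinear V -> V -> V}) (e : (\dim {:V}).-tuple V)
  (hbr : is_lie_bracket br)
  (hnil : two_step_nilpotent br)
  (hHKT : is_HKT br J g)
  (hnabla : is_bismut br J g nabla)
  (hD : is_levi_civita br g D)
  (he : is_orthonormal_basis g e) :
  [/\ forall X Y, ricci br g nabla e X Y = ricci br g nabla e Y X,
      forall X Y, codiff3 D e (torsion_form br g nabla) X Y = 0,
      forall a : 'Hom(V, R^o),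
        (forall X, orthogonal_compl g (center br) X -> a X = 0) ->
        forall X Y, cov1 nabla X a Y = 0
    & forall i X, lee_form (J i) g D e X = 0].
Proof.
have abJ := HKT_abelian hbr hnil hHKT.
have [[JJ J01 J10 _] gJ _] := hHKT.
have nablaE := bismut_connectionE hbr (JJ 0) (gJ 0) (abJ 0) hnabla.
split.
- move=> X Y; rewrite !(ricciE he hbr hnil nablaE).
  by apply: eq_bigr => j _; rewrite dotC.
- exact: codiff_torsion_form.
- move=> a a0 X Y; rewrite /cov1 a0 ?oppr0 // => Z cZ.
  by rewrite nablaE (bracket_centralr hbr) // linear0r oppr0.
have [q0 q1 q2] : [/\ forall X, J 0 (J 1 X) = - J 1 (J 0 X),
    forall X, J 1 (J 0 X) = - J 0 (J 1 X)
  & forall X, J 2 (J 0 X) = - J 0 (J 2 X)].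
  split=> X; first by rewrite J10.
    by rewrite J01 -J10 opprK.
  by rewrite -[J 2 X]J01 -J10 !(JJ 0) linearN !opprK.
have lee i k X : (forall Y, J i (J k Y) = - J k (J i Y)) ->
    lee_form (J i) g D e X = 0.
  by move=> JiJk; apply: (lee_form_abelian he hbr hnil hD (K := J k)).
by move=> + X; apply: ord3_ind; [exact: lee q0|exact: lee q1|exact: lee q2].
Qed.
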